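(* Let $\mathcal{T}$ be an endomorphism on the Cartesian product of the set of quantum coins and the set of initial states of a quantum walk on $\Gamma=\Gamma(G,S)$, and write $\mathcal{T}(\mathcal{C},|\psi_0\rangle)=(\tilde{\mathcal{C}},|\tilde\psi_0\rangle)$, $\tilde{\mathcal{C}}=(\tilde C_n)_{n=0}^{+\infty}$. Then $\mathcal{T}$ is a generalized unitary quantum walk symmetry on $\Gamma$ if and only if there are an (ordinary) unitary quantum walk symmetry $\mathcal{T}':(\mathcal{C},|\psi_0\rangle)\mapsto(\mathcal{C}',|\psi_0'\rangle)$, $\mathcal{C}'=(C'_n)_{n=0}^{+\infty}$, and a shifted $S$-preserving automorphism $g\phi$ on $G$ such that for every quantum coin $\mathcal{C}$ and every initial state $|\psi_0\rangle$ $$|\tilde\psi_0\rangle=P_{g\phi}|\psi_0'\rangle,\qquad \forall n\in\mathbb{N}_0:\ \tilde C_n=P_{g\phi}C'_nP_{g\phi}^\dagger.$$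
   Context: $\mathbb{N}_0=\{0,1,2,\dots\}$. $G$ is a discrete group generated by a finite set $S$; the Cayley graph $\Gamma=\Gamma(G,S)$ is the directed graph with vertex set $G$ and edge set $\{(g,gs)\mid g\in G,s\in S\}$. $\mathcal{H}_S=\ell^2(G)$ has orthonormal basis $\{|x\rangle\mid x\in G\}$, $\mathcal{H}_C=\ell^2(S)$ has orthonormal basis $\{|c\rangle\mid c\in S\}$, and $\mathcal{H}=\mathcal{H}_S\otimes\mathcal{H}_C$ has orthonormal basis $|x,c\rangle=|x\rangle\otimes|c\rangle$. An operator $A\in GL(\mathcal{H})$ is a local operation if $A=\sum_{x\in G}|x\rangle\langle x|\otimes A_x$ for some $A_x\in GL(\mathcal{H}_C)$. The step operator $T$ on $\mathcal{H}$ is the unitary operator with $T|x,c\rangle=|xc,c\rangle$. A quantum coin is a sequence $\mathcal{C}=(C_n)_{n=0}^{+\infty}$ of local unitary operations on $\mathcal{H}$. Put $W_{\mathcal{C}}(n)=TC_{n-1}TC_{n-2}\cdots TC_0$ for $n\in\mathbb{N}_0$ (so $W_{\mathcal C}(0)=\mathrm{Id}$). An initial state is a vector $|\psi_0\rangle\in\mathcal{H}$. An endomorphism on the Cartesian product of the set of quantum coins and the set of initial states is a map of this product to itself, $\mathcal{T}(\mathcal{C},|\psi_0\rangle)=(\tilde{\mathcal{C}},|\tilde\psi_0\rangle)$. Such $\mathcal{T}$ is a unitary quantum walk symmetry if there is a sequence of local unitary operators $(U_n)_{n=0}^{+\infty}$ such that for each $\mathcal{C}$, each $|\psi_0\rangle$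 and all $n\in\mathbb{N}_0$: $W_{\tilde{\mathcal{C}}}(n)|\tilde\psi_0\rangle=U_nW_{\mathcal{C}}(n)|\psi_0\rangle$. It is a generalized unitary quantum walk symmetry if there are a sequence of local unitary operators $(U_n)_{n=0}^{+\infty}$ and a shifted $S$-preserving automorphism $g\phi$ such that for each $\mathcal{C}$, each $|\psi_0\rangle$ and all $n\in\mathbb{N}_0$: $W_{\tilde{\mathcal{C}}}(n)|\tilde\psi_0\rangle=P_{g\phi}U_nW_{\mathcal{C}}(n)|\psi_0\rangle$. A shifted $S$-preserving automorphism on $G$ is a map $g\phi:G\to G$, $x\mapsto g\cdot\phi(x)$, where $g\in G$ and $\phi$ is an automorphism of $G$ with $\phi(S)=S$. Its total permutation operator is $P_{g\phi}=P^{(S)}_{g\phi}\otimes P^{(C)}_{g\phi}$ on $\mathcal{H}$, where $P^{(S)}_{g\phi}|x\rangle=|g\phi(x)\rangle$ for $x\in G$ and $P^{(C)}_{g\phi}|c\rangle=|\phi(c)\rangle$ for $c\in S$. *)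

(* Defs.v *)
From HB Require Import structures.
From mathcomp Require Import all_boot all_order all_algebra finmap complex.
From mathcomp Require Import boolp classical_sets functions cardinality fsbigop.
From mathcomp Require Import reals ereal esum.
From mathcomp Require Import ring lra.

Set Implicit Arguments.
Unset Strict Implicit.
Unset Printing Implicit Defensive.

Import Order.TTheory GRing.Theory Num.Theory.
Import ComplexField.Normc.

Local Open Scope classical_set_scope.
Local Open Scope ring_scope.

Definition sqnorm (R : realType) (I : choiceType) (u : I -> R[i]) : \bar R :=
  \esum_(i in [set: I]) (normc (u i) ^+ 2)%:E.

Definition square_summable (R : realType) (I : choiceType) :
  {pred (I -> R[i])} := fun u => `[< (sqnorm u < +oo)%E >].

Section SquareSummable.
Variables (R : realType) (I : choiceType).
Implicit Types u v : I -> R[i].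

Lemma sqnorm_ge0 u : (0 <= sqnorm u)%E.
Proof. by apply: esum_ge0 => i _; rewrite lee_fin sqr_ge0. Qed.

Lemma square_summableP u : reflect
  (exists M : R, forall F : {fset I}, \sum_(i <- F) normc (u i) ^+ 2 <= M)
  (u \in @square_summable R I).
Proof.
apply: (iffP (asboolP _)) => [uoo|[M uM]].
  exists (fine (sqnorm u)) => F.
  rewrite -lee_fin fineK ?ge0_fin_numE ?sqnorm_ge0//.
  apply: ereal_sup_ubound; exists [set` F]; first by split.
  by rewrite fsbig_finite//= set_fsetK sumEFin.
apply: (@le_lt_trans _ _ M%:E); last exact: ltry.
apply: ge_ereal_sup => _ [F [finF _] <-].
by rewrite fsbig_finite//= sumEFin lee_fin.
Qed.

Lemma normcD_sqr (x y : R[i]) :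
  normc (x + y) ^+ 2 <= 2 * normc x ^+ 2 + 2 * normc y ^+ 2.
Proof.
case: x y => [a b] [c d] /=.
rewrite !sqr_sqrtr ?addr_ge0 ?sqr_ge0// -subr_ge0.
have -> : 2 * (a ^+ 2 + b ^+ 2) + 2 * (c ^+ 2 + d ^+ 2)
    - ((a + c) ^+ 2 + (b + d) ^+ 2) = (a - c) ^+ 2 + (b - d) ^+ 2.
  by ring.
by rewrite addr_ge0 ?sqr_ge0.
Qed.

Lemma square_summable_submod : submod_closed (@square_summable R I).
Proof.
split=> [|a u v /square_summableP[M uM] /square_summableP[N vN]].
  apply/square_summableP; exists 0 => F; rewrite big1// => i _.
  by rewrite [(0 : I -> R[i]) i]/(0 : R[i]) normc0 expr0n.
apply/square_summableP; exists (2 * normc a ^+ 2 * M + 2 * N) => F.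
apply: (@le_trans _ _ (\sum_(i <- F)
    (2 * normc a ^+ 2 * normc (u i) ^+ 2 + 2 * normc (v i) ^+ 2))).
  apply: ler_sum => i _; apply: le_trans (normcD_sqr _ _) _.
  by rewrite lerD2r -mulrA ler_pM2l// -exprMn -normcM.
rewrite big_split/= -!mulr_sumr; apply: lerD; apply: ler_wpM2l => //.
by apply: mulr_ge0 => //; exact: sqr_ge0.
Qed.

HB.instance Definition _ :=
  GRing.isSubmodClosed.Build R[i] (I -> R[i]) (@square_summable R I)
    square_summable_submod.

Record l2 := L2 { l2_val :> I -> R[i]; l2_valP : l2_val \in @square_summable R I }.

HB.instance Definition _ := [isSub for l2_val].
HB.instance Definition _ := [Choice of l2 by <:].
HB.instance Definition _ := [SubChoice_isSubLmodule of l2 by <:].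

Lemma l2_ext (u v : l2) : u =1 v -> u = v.
Proof. by move=> uv; apply/val_inj/funext. Qed.

End SquareSummable.
Arguments l2 : clear implicits.

(* Unconditional sums, meaningful for absolutely summable families; the terms of
   dot are absolutely summable by the Cauchy-Schwarz inequality. *)
Definition rsum (R : realType) (I : choiceType) (f : I -> R) : R :=
  fine (\esum_(i in [set: I]) (Num.max (f i) 0)%:E)
  - fine (\esum_(i in [set: I]) (Num.max (- f i) 0)%:E).

Definition csum (R : realType) (I : choiceType) (f : I -> R[i]) : R[i] :=
  (rsum (fun i => complex.Re (f i)) +i*
   rsum (fun i => complex.Im (f i)))%C.

(* Conjugate-linear in the first argument. *)
Definition dot (R : realType) (I : choiceType) (u v : l2 R I) : R[i] :=
  csum (fun i => (u i)^*%C * v i).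

Definition l2norm (R : realType) (I : choiceType) (u : l2 R I) : R :=
  Num.sqrt (fine (sqnorm u)).

Section Ket.
Variables (R : realType) (I : choiceType).

Lemma ket_subproof (i : I) :
  (fun j => (j == i)%:R : R[i]) \in @square_summable R I.
Proof.
apply/square_summableP; exists 1 => F.
case: (boolP (i \in F)) => iF.
  rewrite (big_fsetD1 i)//= eqxx normc1 expr1n big1_seq ?addr0// => j.
  by rewrite !inE => /andP[_ /andP[/negPf-> _]]; rewrite normc0 expr0n.
rewrite big1_seq// => j /andP[_ jF].
case: eqVneq => [ji|_]; first by rewrite -ji jF in iF.
by rewrite normc0 expr0n.
Qed.

Definition ket (i : I) : l2 R I := L2 (ket_subproof i).

End Ket.
Arguments ket {R I}.

Section TensorProduct.
Variables (R : realType) (I J : choiceType).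

Lemma tens_subproof (u : l2 R I) (v : l2 R J) :
  (fun k : I * J => u k.1 * v k.2) \in @square_summable R (I * J)%type.
Proof.
have /square_summableP[M uM] := l2_valP u.
have /square_summableP[N vN] := l2_valP v.
apply/square_summableP; exists (M * N) => F.
pose A := [fset k.1 | k in F]%fset; pose B := [fset k.2 | k in F]%fset.
have N0 : 0 <= N by have := vN fset0; rewrite big_nil.
apply: (@le_trans _ _ (\sum_(i <- A) \sum_(j <- B)
   normc (u i) ^+ 2 * normc (v j) ^+ 2)); last first.
  apply: (@le_trans _ _ (\sum_(i <- A) normc (u i) ^+ 2 * N)).
    by apply: ler_sum => i _; rewrite -mulr_sumr ler_wpM2l ?sqr_ge0.
  by rewrite -mulr_suml ler_wpM2r.
rewrite pair_big_dep_cond/=.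
set K := Imfset.imfset2 _ _ _ _.
have FK : (F `<=` K)%fset.
  apply/fsubsetP => -[i j] ijF.
  have iA : i \in A by apply/imfsetP; exists (i, j).
  have jB : j \in B by apply/imfsetP; exists (i, j).
  by apply/imfset2P; exists i; rewrite ?inE/= ?iA//; exists j; rewrite ?inE/= ?jB.
rewrite [leRHS](big_fsetID _ (mem F))/=.
rewrite (_ : [fset x | x in K & x \in F]%fset = F); last first.
  apply/fsetP => x; rewrite !inE/= andbC.
  case: (boolP (x \in F)) => //= xF; rewrite !andbT.
  by apply/andP; split; apply/imfsetP; exists x.
rewrite -[leLHS]addr0 lerD//; last first.
  by rewrite sumr_ge0// => k _; rewrite mulr_ge0 ?sqr_ge0.
by apply: ler_sum => k _; rewrite normcM exprMn.
Qed.

Definition tens (u : l2 R I) (v : l2 R J) : l2 R (I * J)%type :=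
  L2 (tens_subproof u v).

Lemma tens_ket (i : I) (j : J) : tens (ket i) (ket j) = ket (i, j).
Proof.
by apply: l2_ext => -[a b]; rewrite /= xpair_eqE -natrM mulnb.
Qed.

End TensorProduct.

Lemma csum_reindex (R : realType) (I J : choiceType) (s : I -> J)
    (f : J -> R[i]) : bijective s -> csum f = csum (f \o s).
Proof.
move=> bs; have bij : set_bij [set: I] [set: J] s by rewrite setTT_bijective.
by rewrite /csum /rsum !(reindex_esum _ _ _ _ bij).
Qed.

Lemma rsum1 (R : realType) (I : choiceType) (i : I) (f : I -> R) :
  (forall j, j != i -> f j = 0) -> rsum f = f i.
Proof.
move=> f0.
have E (g : I -> R) : (forall j, j != i -> g j = 0) ->
    fine (\esum_(j in [set: I]) (Num.max (g j) 0)%:E) = Num.max (g i) 0.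
  move=> g0; rewrite -[RHS]/(fine (Num.max (g i) 0)%:E).
  rewrite -(@esum_set1 R I i (fun j => (Num.max (g j) 0)%:E)); last first.
    by rewrite lee_fin le_max lexx orbT.
  congr fine; rewrite [RHS]esum_mkcond; apply: eq_esum => j _.
  case: ifPn => //; rewrite notin_setE/= => /eqP/g0 ->.
  by rewrite maxxx.
rewrite /rsum !E//; last by move=> j /f0 ->; rewrite oppr0.
by case: (leP (f i) 0) => fi; case: (leP (- f i) 0) => fi'; lra.
Qed.

Lemma dot_ketl (R : realType) (I : choiceType) (i : I) (u : l2 R I) :
  dot (ket i) u = u i.
Proof.
rewrite /dot /csum !(@rsum1 _ _ i); first last.
- by move=> j /negPf ji; rewrite /= ji conjc0 mul0r.
- by move=> j /negPf ji; rewrite /= ji conjc0 mul0r.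
by rewrite /= eqxx conjc1 mul1r; case: (u i).
Qed.

Section Operators.
Variables (R : realType) (I : choiceType).
Local Notation H := (l2 R I).

(* Bounded linear operators on the Hilbert space H. *)
Record op := Op {
  op_fun :> H -> H;
  op_linear : linear op_fun;
  op_bounded : exists M : R, forall u, l2norm (op_fun u) <= M * l2norm u }.

Lemma op_ext (A B : op) : A =1 B -> A = B.
Proof.
case: A B => [A lA bA] [B lB bB] /= /funext AB; case: B / AB in lB bB *.
by rewrite (Prop_irrelevance lA lB) (Prop_irrelevance bA bB).
Qed.

HB.instance Definition _ := gen_eqMixin op.
HB.instance Definition _ := gen_choiceMixin op.
HB.instance Definition _ (A : op) :=
  GRing.isLinear.Build R[i] H H *:%R (op_fun A) (op_linear A).

Lemma op_id_bounded : exists M : R, forall u : H, l2norm u <= M * l2norm u.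
Proof. by exists 1 => u; rewrite mul1r. Qed.

Definition op_id : op := @Op id (fun _ _ _ => erefl) op_id_bounded.

Lemma op_comp_linear (A B : op) : linear (A \o B).
Proof. by move=> a u v /=; rewrite !linearP. Qed.

Lemma op_comp_bounded (A B : op) :
  exists M : R, forall u, l2norm ((A \o B) u) <= M * l2norm u.
Proof.
case: (op_bounded A) (op_bounded B) => [M AM] [N BN].
exists (`|M| * N) => u /=; apply: le_trans (AM _) _.
apply: (@le_trans _ _ (`|M| * l2norm (B u))).
  by apply: ler_wpM2r; [exact: sqrtr_ge0|exact: ler_norm].
by rewrite -mulrA; apply: ler_wpM2l.
Qed.

Definition op_comp (A B : op) : op :=
  Op (op_comp_linear A B) (op_comp_bounded A B).

Definition is_adjoint (A B : op) := forall u v, dot (A u) v = dot u (B v).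

(* The adjoint; the default value is irrelevant, as every bounded operator
   has exactly one adjoint. *)
Definition adj (A : op) : op := xget op_id [set B | is_adjoint A B].

Lemma adj_unique (A B : op) : is_adjoint A B -> adj A = B.
Proof.
move=> AB; apply: xget_unique => // C AC; apply: op_ext => v.
by apply: l2_ext => i; rewrite -!dot_ketl -AB -AC.
Qed.

Definition unitary (A : op) :=
  [/\ is_adjoint A (adj A), op_comp (adj A) A = op_id
    & op_comp A (adj A) = op_id].

(* GL(H) *)
Definition invertible (A : op) :=
  exists B, op_comp A B = op_id /\ op_comp B A = op_id.

End Operators.
Arguments op_id {R I}.
Declare Scope op_scope.
Delimit Scope op_scope with op.
Notation "A \o B" := (op_comp A B) : op_scope.

(* The operator permuting the standard basis along a bijection s,
   i.e. ket i |-> ket (s i), see perm_op_ket. *)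
Section PermutationOperators.
Variables (R : realType) (I : choiceType).
Implicit Types s : I -> I.

Definition preim_of s (i : I) : I := xget i [set j | s j = i].

Lemma preim_ofK s : bijective s -> cancel s (preim_of s).
Proof. by move=> bs i; apply: xget_unique => // j; exact: (bij_inj bs). Qed.

Lemma preim_ofKV s : bijective s -> cancel (preim_of s) s.
Proof.
by move=> bs i; case: (bs) => s' _ s'K; rewrite -{1}(s'K i) preim_ofK.
Qed.

Lemma preim_of_bij s : bijective s -> bijective (preim_of s).
Proof. by move=> bs; exists s; [exact: preim_ofKV|exact: preim_ofK]. Qed.

Variables (s : I -> I) (bs : bijective s).

Lemma sqnorm_preim (u : I -> R[i]) : sqnorm (u \o preim_of s) = sqnorm u.
Proof.
have bij : set_bij [set: I] [set: I] (preim_of s).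
  by rewrite setTT_bijective; exact: preim_of_bij.
by rewrite /sqnorm [RHS](reindex_esum _ _ _ _ bij).
Qed.

Lemma perm_op_subproof (u : l2 R I) :
  u \o preim_of s \in @square_summable R I.
Proof.
by apply/asboolP; rewrite sqnorm_preim; apply/asboolP; exact: l2_valP.
Qed.

Definition perm_fun (u : l2 R I) : l2 R I := L2 (perm_op_subproof u).

Lemma perm_fun_linear : linear perm_fun.
Proof. by move=> a u v; apply: l2_ext => i. Qed.

Lemma perm_fun_bounded :
  exists M : R, forall u, l2norm (perm_fun u) <= M * l2norm u.
Proof. by exists 1 => u; rewrite mul1r /l2norm sqnorm_preim. Qed.

Definition perm_op : op R I := Op perm_fun_linear perm_fun_bounded.

Lemma perm_op_ket (i : I) : perm_op (ket i) = ket (s i).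
Proof.
by apply: l2_ext => j; rewrite /= -(inj_eq (bij_inj bs)) preim_ofKV.
Qed.

End PermutationOperators.

Lemma perm_op_adjoint (R : realType) (I : choiceType) (s : I -> I)
    (bs : bijective s) :
  is_adjoint (perm_op R bs) (perm_op R (preim_of_bij bs)).
Proof.
move=> u v; rewrite /dot (csum_reindex _ bs); congr csum.
apply/funext => i /=; rewrite preim_ofK//; congr (_ * v _).
by apply: (bij_inj (preim_of_bij bs)); rewrite preim_ofK ?preim_ofKV//;
  exact: preim_of_bij.
Qed.

Lemma perm_op_unitary (R : realType) (I : choiceType) (s : I -> I)
    (bs : bijective s) : unitary (perm_op R bs).
Proof.
have bs' := preim_of_bij bs.
rewrite /unitary (adj_unique (@perm_op_adjoint R I s bs)).
split; first exact: perm_op_adjoint.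
- by apply: op_ext => u; apply: l2_ext => i; rewrite /= preim_ofKV.
- by apply: op_ext => u; apply: l2_ext => i; rewrite /= preim_ofK.
Qed.

Section QuantumWalks.
Variables (R : realType) (G : groupType) (S : {fset G}).
Local Open Scope group_scope.

(* H_S is l2 R G, H_C is l2 R S, and the tensor product of H_S and H_C is
   realized as l2 R (G * S), with tens for the tensor of two vectors. *)
Local Notation H := (l2 R (G * S)%type).
Local Notation opH := (op R (G * S)%type).

Definition generates :=
  forall K : {pred G}, group_closed K -> {subset S <= K} -> K =i predT.

Lemma fiber_subproof (x : G) (psi : H) :
  (fun c => psi (x, c)) \in @square_summable R S.
Proof.
have /square_summableP[M psiM] := l2_valP psi.
apply/square_summableP; exists M => F.
apply: le_trans (psiM [fset (x, c) | c in F]%fset).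
by rewrite big_imfset//= => c d _ _ [].
Qed.

(* <x| (x) Id : H -> H_C *)
Definition fiber (x : G) (psi : H) : l2 R S := L2 (fiber_subproof x psi).

(* A is the sum over x of |x><x| (x) A_x: evaluated at psi and read in the
   fibre of x, the sum is A_x applied to <x|psi. *)
Definition local_op (A : opH) :=
  invertible A /\
  exists A_ : G -> op R S, (forall x, invertible (A_ x)) /\
    forall psi x, fiber x (A psi) = A_ x (fiber x psi).

Definition local_unitary (A : opH) := local_op A /\ unitary A.

(* Right translation, along the edge (x, x c) of the Cayley graph. *)
Definition step_fun (k : G * S) : G * S := (k.1 * val k.2, k.2).

Lemma step_fun_bij : bijective step_fun.
Proof.
exists (fun k : G * S => (k.1 * (val k.2)^-1, k.2)) => -[x c].
  by rewrite /step_fun/= mulgK.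
by rewrite /step_fun/= mulgVK.
Qed.

Definition step : opH := perm_op R step_fun_bij.

Lemma step_ket x c : step (ket (x, c)) = ket (x * val c, c).
Proof. exact: perm_op_ket. Qed.

Record quantum_coin := QuantumCoin {
  coin_op :> nat -> opH;
  coin_opP : forall n, local_unitary (coin_op n) }.

Fixpoint walk (C : quantum_coin) (n : nat) : opH :=
  if n is m.+1 then (step \o C m \o walk C m)%op else op_id.

Record shifted_aut := ShiftedAut {
  shift : G;
  aut :> G -> G;
  aut_morph : {morph aut : x y / x * y};
  aut_bij : bijective aut;
  aut_S : [fset aut c | c in S]%fset = S }.

Section TotalPermutation.
Variable a : shifted_aut.

(* The map written g phi. *)
Definition site_map (x : G) : G := shift a * aut a x.

Lemma site_map_bij : bijective site_map.
Proof.
by apply: bij_comp (aut_bij a); exists (fun y => (shift a)^-1 * y);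
  [exact: mulKg|exact: mulVKg].
Qed.

Lemma coin_map_subproof (c : S) : aut a (val c) \in S.
Proof.
suff : aut a (val c) \in [fset aut a d | d in S]%fset by rewrite aut_S.
by apply/imfsetP; exists (val c) => //; exact: valP.
Qed.

Definition coin_map (c : S) : S := [` coin_map_subproof c]%fset.

Lemma coin_map_bij : bijective coin_map.
Proof.
apply: injF_bij => c d /(congr1 val)/= /(bij_inj (aut_bij a)).
exact: val_inj.
Qed.

Definition site_perm : op R G := perm_op R site_map_bij.
Definition coin_perm : op R S := perm_op R coin_map_bij.

Definition total_map (k : G * S) : G * S := (site_map k.1, coin_map k.2).

Lemma total_map_bij : bijective total_map.
Proof.
have [f fK Kf] := site_map_bij; have [h hK Kh] := coin_map_bij.
by exists (fun k => (f k.1, h k.2)) => -[x c]; rewrite /total_map/= ?fK ?hK ?Kf ?Kh.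
Qed.

Definition total_perm : opH := perm_op R total_map_bij.

Lemma total_perm_tens (u : l2 R G) (v : l2 R S) :
  total_perm (tens u v) = tens (site_perm u) (coin_perm v).
Proof.
apply: l2_ext => k; rewrite -(preim_ofKV total_map_bij k).
by case: (preim_of _ _) => x c; rewrite /= !preim_ofK//;
  [exact: coin_map_bij|exact: site_map_bij|exact: total_map_bij].
Qed.

End TotalPermutation.

Definition walk_endo := quantum_coin * H -> quantum_coin * H.

Definition unitary_symmetry (T : walk_endo) :=
  exists U : nat -> opH, (forall n, local_unitary (U n)) /\
    forall C psi n,
      walk (T (C, psi)).1 n (T (C, psi)).2 = U n (walk C n psi).

Definition generalized_unitary_symmetry (T : walk_endo) :=
  exists (U : nat -> opH) (a : shifted_aut),
    (forall n, local_unitary (U n)) /\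
    forall C psi n,
      walk (T (C, psi)).1 n (T (C, psi)).2
      = total_perm a (U n (walk C n psi)).

End QuantumWalks.

(* Main.v *)
(* The total permutation P of a shifted automorphism commutes with the step
   operator, since (g phi(x)) phi(c) = g phi(x c), and conjugation by P maps local
   unitaries to local unitaries. Hence walking with the coins P C_n P^dagger is
   the conjugate by P of walking with the coins C_n, and T' is obtained from T
   by undoing P on the coins and on the initial state. *)
Require Import Defs.
From mathcomp Require Import all_boot all_algebra finmap reals.

Set Implicit Arguments.
Unset Strict Implicit.
Unset Printing Implicit Defensive.

Section Unitary.
Variables (R : realType) (I : choiceType).
Implicit Types A B : op R I.

Lemma op_compE A B u : (A \o B)%op u = A (B u).
Proof. by []. Qed.

Lemma unitaryK A : unitary A -> cancel A (adj A).
Proof. by case=> _ AK _ u; rewrite -[LHS]/((adj A \o A)%op u) AK. Qed.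

Lemma unitaryKV A : unitary A -> cancel (adj A) A.
Proof. by case=> _ _ AK u; rewrite -[LHS]/((A \o adj A)%op u) AK. Qed.

Lemma unitary_invertible A : unitary A -> invertible A.
Proof. by case=> _ AK KA; exists (adj A). Qed.

Lemma invertible_comp A B :
  invertible A -> invertible B -> invertible (A \o B)%op.
Proof.
case=> A' [AA' A'A] [B' [BB' B'B]]; exists (B' \o A')%op.
split; apply: op_ext => u /=.
  by rewrite -[B (B' _)]/((B \o B')%op _) BB' -[LHS]/((A \o A')%op u) AA'.
by rewrite -[A' (A _)]/((A' \o A)%op _) A'A -[LHS]/((B' \o B)%op u) B'B.
Qed.

Lemma adjK A : unitary A -> adj (adj A) = A.
Proof.
move=> uA; apply: adj_unique => u v; have [adjA _ _] := uA.
(* With [v] written as [adj A (A v)], the defining relation of [adj A] moves the adjoint back to the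
   left argument, where it meets [adj A u]. *)
by rewrite -{1}(unitaryK uA v) -adjA unitaryKV.
Qed.

Lemma unitary_adj A : unitary A -> unitary (adj A).
Proof.
move=> uA; rewrite /unitary adjK//; have [adjA AK KA] := uA.
by split=> // u v; rewrite -{1}(unitaryK uA v) -adjA unitaryKV.
Qed.

Lemma unitary_comp A B : unitary A -> unitary B -> unitary (A \o B)%op.
Proof.
move=> uA uB; have [adjA _ _] := uA; have [adjB _ _] := uB.
have adjAB : is_adjoint (A \o B)%op (adj B \o adj A)%op.
  by move=> u v; rewrite /= adjA adjB.
rewrite /unitary (adj_unique adjAB); split=> //; apply: op_ext => u /=.
  by rewrite !unitaryK.
by rewrite !unitaryKV.
Qed.

(** Evaluation at [s i] eliminates [preim_of]; since [s] is onto, it suffices to compare vectors at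
    such indices. *)
Lemma perm_opE (s : I -> I) (bs : bijective s) (u : l2 R I) i :
  perm_op R bs u (s i) = u i.
Proof. by rewrite /= preim_ofK. Qed.

End Unitary.

Section TotalPermutation.
Variables (R : realType) (G : groupType) (S : {fset G}) (a : shifted_aut S).
Local Notation P := (total_perm R a).

Lemma total_perm_unitary : unitary P.
Proof. exact: perm_op_unitary. Qed.

Lemma total_map_step k :
  total_map a (step_fun k) = step_fun (total_map a k).
Proof.
by case: k => x c; rewrite /total_map /step_fun /site_map/= aut_morph mulgA.
Qed.

Lemma total_perm_step u : P (step R S u) = step R S (P u).
Proof.
apply: l2_ext => k.
(* Every index is [total_map a (step_fun j)] for some [j]; there both sides equal [u j]. *)
rewrite -(preim_ofKV (total_map_bij a) k).
rewrite -(preim_ofKV (step_fun_bij S) (preim_of _ k)).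
by rewrite perm_opE perm_opE total_map_step perm_opE perm_opE.
Qed.

(** The tensor form of [P], read fibrewise: sites move by the site permutation and the coin
    permutation acts inside each fibre. *)
Lemma fiber_total_perm x u :
  fiber (site_map a x) (P u) = coin_perm R a (fiber x u).
Proof.
apply: l2_ext => c; rewrite -(preim_ofKV (coin_map_bij a) c).
rewrite perm_opE -[LHS]/(P u (total_map a (x, preim_of (coin_map a) c))).
exact: perm_opE.
Qed.

Lemma fiber_adj_total_perm x u :
  fiber x (adj P u) = adj (coin_perm R a) (fiber (site_map a x) u).
Proof.
rewrite -{2}(unitaryKV total_perm_unitary u) fiber_total_perm.
by rewrite unitaryK//; exact: perm_op_unitary.
Qed.

Lemma local_unitary_conj A :
  local_unitary A -> local_unitary (adj P \o A \o P)%op.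
Proof.
have uP := total_perm_unitary.
have uQ : unitary (coin_perm R a) by exact: perm_op_unitary.
case=> -[_ [A_ [A_inv AE]]] uA.
have uPAP : unitary (adj P \o A \o P)%op.
  by apply: unitary_comp => //; apply: unitary_comp => //; exact: unitary_adj.
split=> //; split; first exact: unitary_invertible.
(* [P] carries the fibre of [x] to that of [site_map a x], so the block of [A] at the latter site
   acts, conjugated by the coin permutation. *)
exists (fun x => adj (coin_perm R a) \o A_ (site_map a x) \o coin_perm R a)%op.
split=> [x|psi x]; last by rewrite /= fiber_adj_total_perm AE fiber_total_perm.
apply: invertible_comp (unitary_invertible uQ).
by apply: invertible_comp (A_inv _); apply: unitary_invertible;
  exact: unitary_adj.
Qed.

Lemma walk_conj (C C' : quantum_coin R S) n psi :
  (forall m, C m = (P \o C' m \o adj P)%op) ->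
  walk C n (P psi) = P (walk C' n psi).
Proof.
move=> CE; elim: n => [//|n IHn].
rewrite [walk C n.+1]/(step R S \o C n \o walk C n)%op.
rewrite [walk C' n.+1]/(step R S \o C' n \o walk C' n)%op.
(* The factor [adj P] of the new coin cancels the [P] supplied by the induction hypothesis; the
   remaining [P] passes through the step. *)
by rewrite !op_compE IHn CE !op_compE (unitaryK total_perm_unitary) total_perm_step.
Qed.

Definition conj_coin (C : quantum_coin R S) : quantum_coin R S :=
  QuantumCoin (fun n => local_unitary_conj (coin_opP C n)).

Lemma conj_coinK (C : quantum_coin R S) n :
  C n = (P \o conj_coin C n \o adj P)%op.
Proof.
apply: op_ext => u; rewrite !op_compE.
by rewrite !(unitaryKV total_perm_unitary).
Qed.

End TotalPermutation.

Theorem theorem4 (R : realType) (G : groupType) (S : {fset G})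
    (genS : generates S) (T : walk_endo R S) :
  generalized_unitary_symmetry T <->
  exists (T' : walk_endo R S) (a : shifted_aut S),
    unitary_symmetry T' /\
    forall (C : quantum_coin R S) (psi : l2 R (G * S)%type),
      (T (C, psi)).2 = total_perm R a (T' (C, psi)).2 /\
      forall n : nat,
        (T (C, psi)).1 n =
        (total_perm R a \o (T' (C, psi)).1 n \o adj (total_perm R a))%op.
Proof.
split=> [[U [a [locU TE]]]|[T' [a [[U [locU T'E]] TT']]]]; last first.
  exists U, a; split=> // C psi n; have [-> TC] := TT' C psi.
  by rewrite (walk_conj _ _ TC) T'E.
have uP := total_perm_unitary R a.
(* The relations required of [T'] force this choice. *)
exists (fun p => (conj_coin a (T p).1, adj (total_perm R a) (T p).2)), a.
split; last first.
  by move=> C psi; split=> [|n]; [symmetry; exact: unitaryKV|exact: conj_coinK].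
exists U; split=> // C psi n.
(* After applying the injective [P], the left side is the walk of [T] itself, to which the
   hypothesis on [T] applies. *)
apply: (can_inj (unitaryK uP)).
rewrite -(walk_conj _ _ (conj_coinK a (T (C, psi)).1)).
by rewrite unitaryKV// TE.
Qed.
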